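(* Suppose a backbend sequence $\tilde{\beta}$ converges from below to a $k$-cyclic backbend sequence $\beta$ for some $k \in \mathbb{N}$. Then, $p^{\tilde{\beta}}_c (\mathbb{H}) = p^{\beta}_c (\mathbb{H})$.
   Context: Let $d \geq 2$ and $\mathbb{Z}_+ = \mathbb{N}\cup\{0\}$. The $d$-dimensional body-centered cubic (BCC) lattice is the graph $(\mathbb{V},\mathbb{E})$ with vertex set $\mathbb{V} = \{x \in \mathbb{Z}^d : x_i \equiv x_j \ (\mathrm{mod}\ 2) \text{ for all } i,j\}$ and edge set $\mathbb{E}$ consisting of all unordered pairs $\langle x,y\rangle$ of vertices with $|x_1-y_1| = \cdots = |x_d-y_d| = 1$. Each edge is independently open with probability $p \in [0,1]$ and closed with probability $1-p$; $\mathbb{P}_p$ is the corresponding product measure. For $\widehat{\mathbb{V}} \subseteq \mathbb{V}$, a path in $\widehat{\mathbb{V}}$ is a sequence $x^0,\ldots,x^n$ of distinct vertices of $\widehat{\mathbb{V}}$ with $\langle x^i,x^{i+1}\rangle \in \mathbb{E}$; it is open if all its edges are open. The record level of a path $\pi = (x^0,\ldots,x^n)$ till $x^i$ is $h^i(\pi) = \max_{j \leq i} x^j_d$. A backbend sequence is a map $\beta : \mathbb{Z}_+ \to \mathbb{Z}_+\cup\{\infty\}$, with $\beta_i := \beta(i)$. For $x \in \widehat{\mathbb{V}}$ with $x_d \geq 0$, a path $\pi = (x^0 = x,\ldots,x^n)$ in $\widehat{\mathbb{V}}$ is a $\beta$-backbend path in $\widehat{\mathbb{V}}$ from $x$ to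 $x^n$ if $x^i_d \geq h^i(\pi) - \beta_{h^i(\pi)}$ for every $i$. Let $C^{\beta}_{\widehat{\mathbb{V}}}$ be the random set of $x \in \widehat{\mathbb{V}}$ such that there is an open $\beta$-backbend path in $\widehat{\mathbb{V}}$ from the origin $(0,\ldots,0)$ to $x$. Put $\theta^{\beta}_{\widehat{\mathbb{V}}}(p) = \mathbb{P}_p(|C^{\beta}_{\widehat{\mathbb{V}}}| = \infty)$ and $p^{\beta}_c(\widehat{\mathbb{V}}) = \sup\{p \in [0,1]: \theta^{\beta}_{\widehat{\mathbb{V}}}(p) = 0\}$. A backbend sequence $\beta$ is $k$-cyclic ($k\in\mathbb{N}$) if for all $i \in \{0,\ldots,k-1\}$, $\beta_{kn+i} = \beta_i \in \mathbb{Z}_+$ for all $n \in \mathbb{N}$. A backbend sequence $\tilde\beta$ converges from below to a $k$-cyclic backbend sequence $\beta$ if for all $i \in \{0,\ldots,k-1\}$, $\lim_{n\to\infty}\tilde\beta_{kn+i} = \beta_i$ and $\tilde\beta_{kn+i} \leq \beta_i$ for all $n \in \mathbb{Z}_+$. The half-space is $\mathbb{H} = \{x \in \mathbb{V} : x_d \geq 0\}$. *)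

(* Defs.v *)
From HB Require Import structures.
From mathcomp Require Import all_boot all_order all_algebra finmap.
From mathcomp Require Import all_classical all_reals all_analysis.

Set Implicit Arguments.
Unset Strict Implicit.
Unset Printing Implicit Defensive.

Import Order.TTheory GRing.Theory Num.Theory.
Import numFieldNormedType.Exports.

Local Open Scope classical_set_scope.
Local Open Scope ring_scope.
Local Open Scope fset_scope.

(* The ambient dimension is [n.+1] throughout, so that the last coordinate
   [ord_max] of a point always exists. *)
Notation site n := 'rV[int]_n.+1.

Definition height n (x : site n) : int := x ord0 ord_max.

Definition bcc_vertices n : set (site n) :=
  [set x : site n | forall i j, (x ord0 i = x ord0 j %[mod 2])%Z].

(* An unordered pair <x,y> is the finite set {x, y}. *)
Definition bcc_edges n : set {fset site n} :=
  [set e | exists x y : site n,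
    [/\ e = [fset x; y], bcc_vertices x, bcc_vertices y &
        forall i, `|x ord0 i - y ord0 i| = 1]].

Definition half_space n : set (site n) :=
  [set x : site n | bcc_vertices x /\ 0 <= height x].

Notation bond n := (set_type (@bcc_edges n)).

Definition cylinders n : set (set (bond n -> bool)) :=
  [set A | exists (e : bond n) (B : set bool), A = [set w | B (w e)]].

(* [true] means open; the sigma-algebra is the product one. *)
Notation config n := (g_sigma_algebraType (@cylinders n)).

Definition product_bernoulli (R : realType) n
    (P : probability (config n) R) (p : R) : Prop :=
  forall (A : {fset bond n}) (B : bond n -> set bool),
    P [set w : config n | forall e, e \in A -> B e (w e)] =
    (\prod_(e <- A) bernoulli_prob p (B e))%E.

Definition is_path n (W : set (site n)) (s : seq (site n)) : Prop :=
  [/\ s <> [::], uniq s, (forall x, x \in s -> W x) &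
      forall i, (i.+1 < size s)%N -> bcc_edges [fset s`_i; s`_i.+1]].

Definition open_edges n (w : config n) : set {fset site n} :=
  [set \val e | e in [set e : bond n | w e]].

Definition open_path n (w : config n) (s : seq (site n)) : Prop :=
  forall i, (i.+1 < size s)%N -> open_edges w [fset s`_i; s`_i.+1].

Definition record_level n (s : seq (site n)) (i : nat) : int :=
  \big[Num.max/height s`_0]_(j < i.+1) height s`_j.

(* Z_+ with infinity adjoined, infinity being [None]. *)
Notation natbar := (one_point_compactification nat).

Definition le_natbar (a b : natbar) : bool :=
  match a, b with
  | _, None => true
  | None, Some _ => false
  | Some m, Some l => (m <= l)%N
  end.

(* Record levels of a path starting at height >= 0 are nonnegative, so
   [`|_|%N] is only the conversion from [int] to [nat]. *)
Definition backbend_path n (W : set (site n)) (beta : nat -> natbar)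
    (x y : site n) (s : seq (site n)) : Prop :=
  [/\ is_path W s, head 0 s = x, last 0 s = y, 0 <= height x &
      forall i, (i < size s)%N ->
        match beta `|record_level s i|%N return Prop with
        | Some b => record_level s i - b%:Z <= height s`_i
        | None => True
        end].

Definition cluster n (W : set (site n)) (beta : nat -> natbar) (w : config n) :
    set (site n) :=
  [set x | exists s, backbend_path W beta 0 x s /\ open_path w s].

Definition theta (R : realType) n (P : R -> probability (config n) R)
    (W : set (site n)) (beta : nat -> natbar) (p : R) : \bar R :=
  P p [set w : config n | infinite_set (cluster W beta w)].

Definition critical_prob (R : realType) n (P : R -> probability (config n) R)
    (W : set (site n)) (beta : nat -> natbar) : R :=
  sup [set p : R | 0 <= p <= 1 /\ theta P W beta p = 0%E].

Definition cyclic_backbend (k : nat) (beta : nat -> natbar) : Prop :=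
  forall i, (i < k)%N ->
    beta i <> None /\ forall m, (0 < m)%N -> beta (k * m + i)%N = beta i.

Definition converges_from_below (k : nat) (tbeta beta : nat -> natbar) : Prop :=
  forall i, (i < k)%N ->
    (tbeta (k * m + i)%N @[m --> \oo] --> beta i) /\
    forall m, le_natbar (tbeta (k * m + i)%N) (beta i).

(* Main.v *)
Require Import Defs.
From mathcomp Require Import all_boot all_order all_algebra finmap.
From mathcomp Require Import all_classical all_reals all_analysis.
From mathcomp Require Import zify.

(** Since [tbeta] converges to the integer-valued periodic sequence [beta] and
    lies below it, the two sequences agree from some multiple [k * M] of the
    period on ([eventually_equal]) and [tbeta <= beta] everywhere
    ([le_everywhere]).  The second fact makes every [tbeta]-backbend path a
    [beta]-backbend path, so that [theta tbeta <= theta beta].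

    For the other direction, percolation is started at the top of a diagonal
    open column.  If the edge from the origin to [up = (1, ..., 1)] is open and
    the half-space seen from [up] percolates for the sequence
    [gamma (_ + 1)], then prefixing the paths from [up] by the origin shows
    that the half-space percolates for [gamma] ([cluster_up]): the prefix goes
    straight up, hence imposes no constraint, and it raises every later record
    level by exactly one.  The edges of the half-space based at [up] are
    distinct from the first edge, so the two events are independent, and the
    second has the law of percolation in the half-space itself.  Hence
    [p * theta (gamma (_ + 1)) <= theta gamma] ([theta_succ]).  Iterating
    [k * M] times from [gamma = tbeta] leads to [tbeta (_ + k * M)], which is
    [beta] by periodicity.  So for [p > 0] the functions [theta tbeta] and
    [theta beta] vanish at the same parameters, and the two critical
    probabilities, suprema of subsets of [[0, 1]] that differ at most by the
    point [0], are equal; the supremum of the empty set being [0] by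
    convention, this holds for empty sets as well.

    Independence and translation invariance are obtained together
    ([independent_reindex]) by comparing two finite measures on the pi-system
    of the events that a finite set of edges is open. *)

Set Implicit Arguments.
Unset Strict Implicit.
Unset Printing Implicit Defensive.

Import Order.TTheory GRing.Theory Num.Theory.

Local Open Scope fset_scope.
Local Open Scope classical_set_scope.
Local Open Scope ring_scope.

(* The topological notion of cluster point has the same name. *)
Local Notation cluster := Defs.cluster.

(** * Measurability of the percolation event *)

Section countable_quantifiers.
Context d (T : measurableType d).

Lemma measurable_exists (I : countType) (Q : I -> T -> Prop) :
  (forall i, measurable [set w | Q i w]) ->
  measurable [set w | exists i, Q i w].
Proof.
move=> mQ; rewrite [X in measurable X](_ : _ = \bigcup_i [set w | Q i w]).
  exact: countable_bigcupT_measurable.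
by apply/seteqP; split=> [w [i Qi]|w [i _ Qi]]; exists i.
Qed.

Lemma measurable_forall (I : countType) (Q : I -> T -> Prop) :
  (forall i, measurable [set w | Q i w]) ->
  measurable [set w | forall i, Q i w].
Proof.
move=> mQ.
rewrite [X in measurable X](_ : _ = ~` [set w | exists i, ~ Q i w]).
  by apply/measurableC/measurable_exists => i; exact: (measurableC (mQ i)).
apply/seteqP; split=> [w Qw [i]|w nQ i]; first by apply.
by apply: contrapT => nQi; apply: nQ; exists i.
Qed.

Lemma measurable_and_const (b : Prop) (Q : T -> Prop) :
  measurable [set w | Q w] -> measurable [set w | b /\ Q w].
Proof.
move=> mQ; have [hb|nb] := pselect b.
  rewrite [X in measurable X](_ : _ = [set w | Q w])//.
  by apply/seteqP; split=> w // [].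
by rewrite [X in measurable X](_ : _ = set0)//; apply/seteqP; split=> w // [].
Qed.

Lemma measurable_imply_const (b : Prop) (Q : T -> Prop) :
  (b -> measurable [set w | Q w]) -> measurable [set w | b -> Q w].
Proof.
move=> mQ; have [hb|nb] := pselect b.
  rewrite [X in measurable X](_ : _ = [set w | Q w]); first exact: mQ.
  by apply/seteqP; split=> w; [exact | move=> ? _].
rewrite [X in measurable X](_ : _ = setT)//.
by apply/seteqP; split=> // w _ /nb.
Qed.

End countable_quantifiers.

Section events.
Variable n : nat.

Lemma measurable_open (e : bond n) : measurable [set w : config n | w e].
Proof.
apply: sub_sigma_algebra; exists e, [set true].
by apply/seteqP; split=> w /=; case: (w e).
Qed.

Lemma measurable_open_edges (f : {fset site n}) :
  measurable [set w : config n | open_edges w f].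
Proof.
have [fE|nfE] := pselect (bcc_edges f).
  rewrite [X in measurable X](_ : _ =
    [set w : config n | w (SigSub (mem_set fE))]); first exact: measurable_open.
  apply/seteqP; split=> w /= => [[e we ef]|wf]; last first.
    by exists (SigSub (mem_set fE)).
  by rewrite (_ : SigSub _ = e)//; apply: val_inj.
rewrite [X in measurable X](_ : _ = set0)//.
apply/seteqP; split=> w // [e _ ef].
by apply: nfE; rewrite -ef; exact: set_valP.
Qed.

Lemma measurable_cluster W beta (x : site n) :
  measurable [set w : config n | cluster W beta w x].
Proof.
apply: measurable_exists => s; apply: measurable_and_const.
apply: measurable_forall => i; apply: measurable_imply_const => _.
exact: measurable_open_edges.
Qed.

(** Infiniteness is expressed with countably many quantifiers, finite sets of
    sites being countably many, so that percolation is a measurable event. *)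
Lemma infinite_set_avoids_fset (T : choiceType) (A : set T) :
  infinite_set A <-> forall B : {fset T}, exists x, x \notin B /\ A x.
Proof.
split=> [Ainf B|AB /finite_fsetP[B AE]]; last first.
  by have [x [xB Ax]] := AB B; move: Ax; rewrite AE /= => /(negP xB).
apply: contrapT => nB; apply: Ainf.
apply: (sub_finite_set (B := [set` B])); last exact: finite_fset.
move=> x Ax /=; apply: contrapT => /negP xB.
by apply: nB; exists x.
Qed.

Lemma measurable_percolates W beta :
  measurable [set w : config n | infinite_set (cluster W beta w)].
Proof.
rewrite [X in measurable X](_ : _ = [set w : config n |
  forall B : {fset site n}, exists x, x \notin B /\ cluster W beta w x]).
  apply: measurable_forall => B; apply: measurable_exists => x.
  by apply: measurable_and_const; exact: measurable_cluster.
by apply/seteqP; split=> w /infinite_set_avoids_fset.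
Qed.

Lemma theta_le (R : realType) (P : R -> probability (config n) R) p
    W beta1 beta2 :
  (forall w, infinite_set (cluster W beta1 w) ->
             infinite_set (cluster W beta2 w)) ->
  (theta P W beta1 p <= theta P W beta2 p)%E.
Proof.
move=> sub; apply: le_measure => //; rewrite inE; exact: measurable_percolates.
Qed.

End events.

(** * Independence and invariance under reindexing of the edges *)

Section reindexing.
Variable n : nat.

Definition all_open (A : {fset bond n}) : set (config n) :=
  [set w | forall e, e \in A -> w e].

(** The edges outside [D] are closed, so that the event [reindex D phi @^-1` E]
    depends only on the states of the edges in [phi @` D]; with [phi = id],
    this replaces [E] by an event depending on [D] only. *)
Definition reindex (D : set (bond n)) (phi : bond n -> bond n) (w : config n) :
  config n := fun e => (e \in D) && w (phi e).

Lemma measurable_all_open A : measurable (all_open A).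
Proof.
rewrite (_ : all_open A = \bigcap_(e in [set` A]) [set w : config n | w e])//.
by apply: fin_bigcap_measurable => // e _; exact: measurable_open.
Qed.

Lemma all_openU A B : all_open (A `|` B)%fset = all_open A `&` all_open B.
Proof.
apply/seteqP; split=> [w AB|w [wA wB] e].
  by split=> e eA; apply: AB; rewrite inE eA ?orbT.
by rewrite inE => /orP[/wA|/wB].
Qed.

(** The finite open events are stable under intersection, have explicit
    probabilities, and determine all cylinders: this is the pi-system on which
    measures are compared below. *)
Lemma measurable_all_openE :
  @measurable _ (config n) = <<s [set all_open A | A in setT] >>.
Proof.
set G := [set _ | _ in _].
apply/seteqP; split; apply: smallest_sub; try exact: smallest_sigma_algebra.
  move=> _ [e [B ->]].
  have mG : @measurable _ (g_sigma_algebraType G) [set w | w e].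
    apply: sub_sigma_algebra; exists [fset e] => //.
    apply/seteqP; split=> w /=; first by apply; rewrite inE.
    by move=> we e'; rewrite inE => /eqP ->.
  have mGT : @measurable _ (g_sigma_algebraType G)
      [set w | B true /\ w e \/ B false /\ ~ w e].
    have mU b (C : set (g_sigma_algebraType G)) : measurable C ->
        measurable [set w | B b /\ C w] by exact: measurable_and_const.
    have := measurableU _ _ (mU true _ mG) (mU false _ (measurableC mG)).
    exact.
  rewrite (_ : [set w | B (w e)] =
    [set w | B true /\ w e \/ B false /\ ~ w e])//.
  apply/seteqP; split=> w /=; case: (w e) => //=; try by move=> [[]|[]].
    by left.
  by right.
by move=> _ [A _ <-]; exact: measurable_all_open.
Qed.

Lemma reindex_all_open D phi A :
  {subset A <= D} ->
  reindex D phi @^-1` all_open A = all_open [fset phi e | e in A]%fset.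
Proof.
move=> AD; apply/seteqP; split=> [w wA e /imfsetP[/= e' e'A ->]|w wA e eA].
  by have /andP[] := wA _ e'A.
apply/andP; split; first exact: AD.
by apply: wA; apply: in_imfset.
Qed.

Lemma reindex_all_open0 D phi A e :
  e \in A -> e \notin D -> reindex D phi @^-1` all_open A = set0.
Proof.
move=> eA eD; apply/seteqP; split=> // w /(_ _ eA).
by rewrite /reindex (negPf eD).
Qed.

Lemma measurable_reindex D phi : measurable_fun setT (reindex D phi).
Proof.
apply: (measurability _ measurable_all_openE) => _ [_ [A _ <-] <-].
rewrite setTI; have [AD|] := pselect {subset A <= D}.
  by rewrite reindex_all_open//; exact: measurable_all_open.
move=> /existsNP[e /not_implyP[eA /negP eD]].
by rewrite (reindex_all_open0 _ eA eD).
Qed.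

Section product_measure.
Variables (R : realType) (P : probability (config n) R) (p : R).
Hypotheses (p01 : 0 <= p <= 1) (hP : product_bernoulli P p).

Lemma probability_all_open A : P (all_open A) = (p ^+ #|` A|)%:E.
Proof.
have := hP A (fun _ => [set true]).
rewrite (_ : [set w | _] = all_open A); last first.
  by apply/seteqP; split=> w /= wA e eA; [rewrite wA|apply/wA].
move=> ->.
rewrite (eq_bigr (fun=> p%:E)); last first.
  move=> e _; rewrite bernoulli_probE// !diracE/= mem_set//= memNset//=.
  by rewrite mule1 mule0 adde0.
by rewrite prodEFin big_const_seq count_predT iter_mulr_1.
Qed.

(** Both sides are finite measures in [E].  On [all_open A] with [A] inside [D],
    they are [p ^+ #|A|.+1], because [phi] is injective and avoids [f];
    if [A] leaves [D], they vanish, as [reindex] closes the edges outside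
    [D]. *)
Lemma independent_reindex (D : set (bond n)) phi f (E : set (config n)) :
  injective phi -> (forall e, e \in D -> phi e <> f) -> measurable E ->
  P ([set w : config n | w f] `&` reindex D phi @^-1` E) =
  (p%:E * P (reindex D id @^-1` E))%E.
Proof.
move=> phi_inj fD mE.
have p0 : 0 <= p by case/andP: p01.
have mphi := measurable_reindex D phi.
have mid := measurable_reindex D id.
pose m1 := measure_function_pushforward__canonical__measure_function_Measure
  (mrestr P (measurable_open f)) mphi.
pose m2 := mscale (NngNum p0)
  (measure_function_pushforward__canonical__measure_function_Measure P mid).
suff /(_ E mE) : forall B, measurable B -> m1 B = m2 B.
  by rewrite /m1 /m2 /= /mscale /= /pushforward /mrestr setIC.
move=> {E mE}.
apply: (measure_unique [set all_open A | A in setT] (fun=> setT)).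
- exact: measurable_all_openE.
- by move=> _ _ [A _ <-] [B _ <-]; exists (A `|` B)%fset; rewrite ?all_openU.
- by move=> _; exists fset0 => //; apply/seteqP; split.
- by rewrite bigcup_const.
- move=> _ [A _ <-]; rewrite /m1 /m2 /= /mscale /= /pushforward /mrestr.
  have [AD|] := pselect {subset A <= D}; last first.
    move=> /existsNP[e /not_implyP[eA /negP eD]].
    by rewrite !(reindex_all_open0 _ eA eD) set0I !measure0 mule0.
  rewrite !reindex_all_open//.
  rewrite (_ : [set w : config n | w f] = all_open [fset f]); last first.
    apply/seteqP; split=> [w wf e|w]; first by rewrite inE => /eqP ->.
    by apply; rewrite inE.
  rewrite -all_openU !probability_all_open -EFinM -exprS; congr (_ ^+ _)%:E.
  rewrite fsetUC cardfsU1 !card_imfset//=.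
  suff -> : f \notin [fset phi e | e in A] by [].
  by apply/imfsetP => -[/= e /AD eD]; apply/nesym/fD.
- move=> _; rewrite /m1 /= /pushforward /mrestr.
  rewrite preimage_setT setTI.
  exact: le_lt_trans (probability_le1 _ (measurable_open f)) (ltry _).
Qed.

End product_measure.

End reindexing.

(** * Prefixing a path by one diagonal step *)

Section diagonal_step.
Variable n : nat.
Implicit Types (x y : site n) (e : bond n) (w : config n) (s : seq (site n)).

Definition up : site n := const_mx 1.

Definition translate (f : {fset site n}) : {fset site n} :=
  [fset (x + up)%R | x in f]%fset.

Lemma translate2 x y : translate [fset x; y] = [fset x + up; y + up].
Proof.
apply/fsetP => z; rewrite !inE; apply/imfsetP/orP => [[/= t]|].
  by rewrite !inE => /orP[] /eqP -> ->; rewrite eqxx; [left|right].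
by case=> /eqP ->; [exists x|exists y]; rewrite //= !inE eqxx ?orbT.
Qed.

Lemma translate_inj : injective translate.
Proof.
have sub (f g : {fset site n}) : translate f = translate g -> {subset f <= g}.
  move=> fg x xf; have : x + up \in translate g.
    by rewrite -fg; apply/imfsetP; exists x.
  by case/imfsetP => /= y yg /addIr ->.
by move=> f g fg; apply/fsetP => x; apply/idP/idP; apply: sub.
Qed.

Lemma bcc_vertices_up x : bcc_vertices x -> bcc_vertices (x + up).
Proof. by move=> xV i j; rewrite !mxE -modzDml (xV i j) modzDml. Qed.

Lemma height_up x : height (x + up) = height x + 1.
Proof. by rewrite /height !mxE. Qed.

Lemma height0 : height (0 : site n) = 0.
Proof. by rewrite /height mxE. Qed.

Lemma bcc_edges_translate f : bcc_edges f -> bcc_edges (translate f).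
Proof.
move=> [x [y [-> xV yV xy]]]; exists (x + up), (y + up).
split; [exact: translate2|exact: bcc_vertices_up|exact: bcc_vertices_up|].
by move=> i; rewrite !mxE opprD addrACA subrr addr0 xy.
Qed.

Lemma bcc_vertices0 : bcc_vertices (0 : site n).
Proof. by move=> i j; rewrite !mxE. Qed.

Lemma bcc_edges0 : bcc_edges [fset (0 : site n); up].
Proof.
exists 0, up; split => //; [exact: bcc_vertices0| |by move=> i; rewrite !mxE].
by rewrite -[up]add0r; exact/bcc_vertices_up/bcc_vertices0.
Qed.

Definition translate_bond e : bond n :=
  SigSub (mem_set (bcc_edges_translate (set_valP e))).

Definition first_bond : bond n := SigSub (mem_set bcc_edges0).

Lemma translate_bond_inj : injective translate_bond.
Proof. by move=> e e' [/translate_inj/val_inj]. Qed.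

Definition half_bonds : set (bond n) :=
  [set e | forall x, x \in val e -> half_space x].

(** The first edge contains the origin, which lies below every translated
    edge of the half-space. *)
Lemma translate_bond_neq_first e :
  e \in half_bonds -> translate_bond e <> first_bond.
Proof.
rewrite inE => eH /(congr1 val) /= e0.
have : 0 \in translate (val e) by rewrite e0 !inE eqxx.
case/imfsetP => /= x /eH [_ x0] /(congr1 (@height n)).
by rewrite height_up height0; lia.
Qed.

(** Paths in the half-space do not see the edges that [reindex] closes, so
    percolation can be replaced by an event of the edges in [half_bonds], to
    which [independent_reindex] applies. *)
Lemma cluster_restrict beta w :
  cluster (@half_space n) beta w `<=`
  cluster (@half_space n) beta (reindex half_bonds id w).
Proof.
move=> x [s [sB sw]]; exists s; split=> // i si.
have [e we eE] := sw i si; exists e => //=.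
rewrite /reindex we andbT inE => z; rewrite eE !inE.
have [[_ _ sH _] _ _ _ _] := sB.
by case/orP => /eqP ->; apply: sH; rewrite mem_nth// ltnW.
Qed.

Lemma nth_translate s i : (i < size s)%N ->
  [seq x + up | x <- s]`_i = s`_i + up.
Proof. by move=> si; rewrite (nth_map 0). Qed.

Lemma le_record_level s j i : (j <= i)%N -> height s`_j <= record_level s i.
Proof.
rewrite -ltnS => ji.
exact: (@le_bigmax _ _ _ _ (fun j : 'I_i.+1 => height s`_j) (Ordinal ji)).
Qed.

Lemma record_level_le s i m :
  (forall j, (j <= i)%N -> height s`_j <= m) -> record_level s i <= m.
Proof. by move=> sm; apply/bigmax_leP; split=> [|[j ji] _]; apply: sm. Qed.

Lemma record_level0 s : record_level s 0 = height s`_0.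
Proof.
apply/le_anti; rewrite (le_record_level s (leqnn 0)) andbT.
by apply: record_level_le => j; rewrite leqn0 => /eqP ->.
Qed.

Lemma record_level_cons s i : (i < size s)%N -> 0 <= height s`_0 ->
  record_level (0 :: [seq x + up | x <- s]) i.+1 = record_level s i + 1.
Proof.
move=> si s0; have r0 := le_trans s0 (le_record_level s (leq0n i)).
apply/le_anti/andP; split.
  apply: record_level_le => -[_|j ji] /=; first by rewrite height0; lia.
  rewrite nth_translate; last exact: leq_ltn_trans si.
  by rewrite height_up lerD2r le_record_level.
rewrite -lerBrDr; apply: record_level_le => j ji.
rewrite lerBrDr -height_up -nth_translate; last exact: leq_ltn_trans si.
exact: (@le_record_level (0 :: _) j.+1 i.+1).
Qed.

(** A path from the origin, translated by [up] and prefixed by the origin, has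
    its record levels raised by one, which turns the constraint of
    [beta \o succn] into that of [beta]; at the added vertex the path is at its
    record level. *)
Lemma cluster_up beta w x : w first_bond ->
  cluster (@half_space n) (beta \o succn)
    (reindex half_bonds translate_bond w) x ->
  cluster (@half_space n) beta w (x + up).
Proof.
move=> w0 [s [[[s_neq0 s_uniq sH sE] s_head s_last _ sB] sw]].
have s_size : (0 < size s)%N by rewrite lt0n size_eq0; apply/eqP.
have s0 : s`_0 = 0 by rewrite nth0.
have s0_ge0 : 0 <= height s`_0 by rewrite s0 height0.
exists (0 :: [seq y + up | y <- s]); split; first split.
- split=> //.
  + rewrite /= map_inj_uniq ?s_uniq ?andbT; last exact: addIr.
    apply/mapP => -[y /sH [_ y0]] /(congr1 (@height n)).
    by rewrite height_up height0; lia.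
  + move=> y; rewrite inE => /orP[/eqP ->|/mapP[z /sH [zV z0] ->]].
      by split; [exact: bcc_vertices0|rewrite height0].
    by split; [exact: bcc_vertices_up|rewrite height_up; lia].
  + case=> [_|i] /=; last rewrite ltnS size_map => si.
      by rewrite nth_translate// s0 add0r; exact: bcc_edges0.
    rewrite !nth_translate ?(ltnW si)// -translate2.
    exact/bcc_edges_translate/sE.
- by [].
- rewrite /= -s_last; case: (s) s_neq0 => //= a l _.
  by rewrite (last_map (+%R^~ up)).
- by rewrite height0.
- case=> [_|i /= si].
    rewrite record_level0 /= height0.
    by case: (beta _) => //= b; lia.
  rewrite size_map ltnS in si.
  rewrite record_level_cons// nth_translate// height_up.
  have := sB i si; have := le_trans s0_ge0 (le_record_level s (leq0n i)).
  move: (record_level s i) => r r0 /=.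
  rewrite (_ : `|(r + 1)%R|%N = `|r|.+1); last lia.
  by case: (beta _) => //= b; lia.
- case=> [_|i] /=; last rewrite ltnS size_map => si.
    by rewrite nth_translate// s0 add0r; exists first_bond.
  rewrite !nth_translate ?(ltnW si)// -translate2.
  have [e /= /andP[_ we] eE] := sw i si.
  by exists (translate_bond e) => //=; rewrite eE.
Qed.

Variables (R : realType) (P : R -> probability (config n) R) (p : R).

(** With probability at least [p * theta (beta \o succn)], the first edge is
    open and the half-space based at [up] percolates. *)
Lemma theta_succ beta : 0 <= p <= 1 -> product_bernoulli (P p) p ->
  (p%:E * theta P (@half_space n) (beta \o succn) p <=
   theta P (@half_space n) beta p)%E.
Proof.
move=> p01 hP; set H := @half_space n.
pose E : set (config n) := [set w | infinite_set (cluster H (beta \o succn) w)].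
have mE : measurable E by exact: measurable_percolates.
have mpre phi : measurable (reindex half_bonds phi @^-1` E).
  by rewrite -[X in measurable X]setTI; exact: measurable_reindex.
apply: (@le_trans _ _ (p%:E * P p (reindex half_bonds id @^-1` E))%E).
  apply: lee_wpmul2l; first by rewrite lee_fin; case/andP: p01.
  apply: le_measure; rewrite ?inE//.
  by move=> w; apply: sub_infinite_set; exact: cluster_restrict.
rewrite -(independent_reindex p01 hP translate_bond_inj
  translate_bond_neq_first mE).
apply: le_measure; rewrite ?inE.
- exact: measurableI (measurable_open _) (mpre _).
- exact: measurable_percolates.
move=> w /= [w0]; apply: contra_not => finC.
apply: (@sub_finite_set _ _ ((+%R^~ up) @^-1` cluster H beta w)).
  by move=> x; exact: cluster_up.
by apply: finite_preimage finC => x y _ _ /addIr.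
Qed.

Lemma theta_add beta L : 0 < p <= 1 -> product_bernoulli (P p) p ->
  theta P (@half_space n) beta p = 0%E ->
  theta P (@half_space n) (fun h => beta (h + L)%N) p = 0%E.
Proof.
move=> /andP[p0 p1] hP; elim: L beta => [|L IHL] beta beta0.
  by under eq_fun do rewrite addn0.
under eq_fun do rewrite addnS.
apply: (IHL (beta \o succn)).
apply/le_anti/andP; split; last exact: measure_ge0.
have p01 : 0 <= p <= 1 by rewrite (ltW p0).
have := theta_succ beta p01 hP.
by rewrite beta0 -[X in (_ <= X)%E](mule0 p%:E) lee_pmul2l.
Qed.

End diagonal_step.

(** * Comparison of the two sequences *)

Lemma cyclic_modn k beta : cyclic_backbend k beta ->
  forall m i, (i < k)%N -> beta (k * m + i)%N = beta i.
Proof.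
by move=> hb [|m] i ik; rewrite ?muln0//; have [_] := hb i ik; apply.
Qed.

(** Finite points of the compactified integers are isolated, so each of the [k]
    convergent subsequences is eventually constant; the maximum of the [k]
    ranks works for all residues. *)
Lemma eventually_equal k tbeta beta : (0 < k)%N -> cyclic_backbend k beta ->
  converges_from_below k tbeta beta ->
  exists M, forall h, tbeta (h + k * M)%N = beta h.
Proof.
move=> k0 hb hc.
have [F FP] : {F : 'I_k -> nat & forall (i : 'I_k) m,
    (F i <= m)%N -> tbeta (k * m + i)%N = beta i}.
  apply: (@choice _ _ (fun (i : 'I_k) M => forall m, (M <= m)%N ->
      tbeta (k * m + i)%N = beta i)).
  move=> i; have [bi _] := hb i (ltn_ord i); have [ci _] := hc i (ltn_ord i).
  case bE : (beta i) bi ci => [b|//] _ ci.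
  have : nbhs (Some b : natbar) [set Some b].
    rewrite -[X in nbhs _ X](image_set1 Some).
    by apply: one_point_compactification_some_nbhs; exact: discrete_set1.
  by move=> /ci [M _ MP]; exists M => m; apply: MP.
exists (\max_i F i)%N => h.
rewrite {1}(divn_eq h k) addnAC mulnC -mulnDr.
have hk : (h %% k < k)%N by rewrite ltn_mod.
rewrite (FP (Ordinal hk)); last first.
  by rewrite (leq_trans (leq_bigmax (Ordinal hk))) ?leq_addl.
by rewrite /= [in RHS](divn_eq h k) mulnC cyclic_modn.
Qed.

Lemma le_everywhere k tbeta beta : (0 < k)%N -> cyclic_backbend k beta ->
  converges_from_below k tbeta beta -> forall h, le_natbar (tbeta h) (beta h).
Proof.
move=> k0 hb hc h; have hk : (h %% k < k)%N by rewrite ltn_mod.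
rewrite (divn_eq h k) mulnC [beta _]cyclic_modn//.
by have [_] := hc _ hk; apply.
Qed.

Lemma cluster_mono n W tbeta beta (w : config n) :
  (forall h, le_natbar (tbeta h) (beta h)) ->
  cluster W tbeta w `<=` cluster W beta w.
Proof.
move=> le_b x [s [[sp sh sl h0 sb] sw]]; exists s; split=> //; split=> // i si.
have := sb i si; have := le_b `|record_level s i|%N.
by case: (tbeta _) (beta _) => [a|] [b|] //=; lia.
Qed.

Theorem corollary3p1 (R : realType) (n : nat) (hn : (2 <= n.+1)%N)
    (P : R -> probability (config n) R)
    (hP : forall p : R, 0 <= p <= 1 -> product_bernoulli (P p) p)
    (k : nat) (hk : (0 < k)%N) (tbeta beta : nat -> natbar)
    (hbeta : cyclic_backbend k beta)
    (htbeta : converges_from_below k tbeta beta) :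
  critical_prob P (@half_space n) tbeta = critical_prob P (@half_space n) beta.
Proof.
have [M tbetaE] := eventually_equal hk hbeta htbeta.
set Z := fun b => [set p : R | 0 <= p <= 1 /\ theta P (@half_space n) b p = 0%E].
have Zsub : Z beta `<=` Z tbeta.
  move=> p [p01 p_sub]; split=> //; apply/le_anti/andP.
  split; last exact: measure_ge0.
  rewrite -p_sub; apply: theta_le => w; apply/sub_infinite_set/cluster_mono.
  exact: le_everywhere hk hbeta htbeta.
have Zsup b : has_ubound (Z b) by exists 1 => p [/andP[]].
have Zpos p : Z tbeta p -> 0 < p -> Z beta p.
  move=> [/[dup] p01 /andP[_ p1] p_sub] p0; split=> //.
  rewrite -(theta_add (k * M) _ (hP _ p01) p_sub) ?p0//.
  by congr theta; apply/funext => h; rewrite tbetaE.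
change (sup (Z tbeta) = sup (Z beta)).
have sup_ge0 b : 0 <= sup (Z b).
  have [->|/set0P[p Zp]] := eqVneq (Z b) set0; first by rewrite sup0.
  have [/andP[p0 _] _] := Zp; exact: le_trans p0 (ub_le_sup (Zsup b) Zp).
apply/le_anti/andP; split.
  have [->|/set0P Z0] := eqVneq (Z tbeta) set0; first by rewrite sup0.
  apply: ge_sup => // p Zp; have [/andP[p0 _] _] := Zp.
  (* At p = 0 the first edge is almost surely closed and [theta_add] does not
     apply, but the parameter 0 lies below any of these suprema. *)
  move: p0; rewrite [0 <= p]le_eqVlt => /orP[/eqP <-//|p0].
  exact: (ub_le_sup (Zsup beta) (Zpos _ Zp p0)).
have [->|/set0P Z0] := eqVneq (Z beta) set0; first by rewrite sup0.
by apply: ge_sup => // p /Zsub Zp; exact: (ub_le_sup (Zsup tbeta) Zp).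
Qed.
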